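(* Suppose $\rho_i=-\rho^*$ for all $i\in\{1,\dots,N\}$, where $\rho^*>0$. Then for all gains $\alpha>0$, $\beta>0$, $\gamma>0$ the closed-loop PID network achieves admissible consensus. Moreover, for every initial condition, all node states converge asymptotically to $$x_\infty=\frac{1}{N}\,\frac{\sum_{k=1}^N\delta_k}{\rho^*},$$ and the quantity $z_\infty:=\lim_{t\to\infty}\|\mathbf z(t)\|$ satisfies $$z_\infty\le\frac{\sqrt{N^3(N-1)}}{\gamma\lambda_2+1}\,\|\mathbf\Delta\|.$$
   Context: Let $N\ge 2$ and let $\mathcal G$ be a connected undirected graph on the nodes $\{1,\dots,N\}$ with symmetric edge weights ($w_{ij}=w_{ji}>0$ if $\{i,j\}$ is an edge, $w_{ij}=0$ otherwise). Its Laplacian $\mathcal L\in\mathbb R^{N\times N}$ has entries $\mathcal L_{ii}=\sum_{j\ne i}w_{ij}$ and $\mathcal L_{ij}=-w_{ij}$ for $i\neq j$; its eigenvalues are $0=\lambda_1<\lambda_2\le\dots\le\lambda_N$. The norm $\|\cdot\|$ of a vector is the Euclidean norm. Closed-loop PID network. The nodes obey $\dot x_i(t)=\rho_i x_i(t)+\delta_i+u_i(t)$, $i\in\{1,\dots,N\}$, with $x_i(t)\in\mathbb R$, constants $\rho_i,\delta_i\in\mathbb R$, and distributed PID control $$u_i(t)=-\sum_{j=1}^N\mathcal L_{ij}\Big(\alpha x_j(t)+\beta\int_0^t x_j(\tau)\,d\tau+\gamma\dot x_j(t)\Big).$$ Put $\mathbf x=[x_1,\dots,x_N]^T$, $\mathbf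 P=\mathrm{diag}\{\rho_1,\dots,\rho_N\}$, $\mathbf\Delta=[\delta_1,\dots,\delta_N]^T$, $\tilde{\mathcal L}=\mathbf I_N+\gamma\mathcal L$ (invertible), and $\mathbf z(t)=[z_1(t),\dots,z_N(t)]^T:=-\beta\tilde{\mathcal L}^{-1}\mathcal L\int_0^t\mathbf x(\tau)\,d\tau$. The closed-loop dynamics are then $$\dot{\mathbf x}=\tilde{\mathcal L}^{-1}(\mathbf P-\alpha\mathcal L)\mathbf x+\mathbf z+\tilde{\mathcal L}^{-1}\mathbf\Delta,\qquad \dot{\mathbf z}=-\beta\tilde{\mathcal L}^{-1}\mathcal L\,\mathbf x,$$ with $\mathbf x(0)$ arbitrary and $\mathbf z(0)=0$. Admissible consensus. Let $\mathfrak C=\{\mathbf x\in\mathbb R^N: x_i=x_j\ \forall i,j\}$. The network achieves admissible consensus if, for any initial conditions $x_i(0)=x_{i0}$, $\lim_{t\to\infty}\mathbf x(t)\in\mathfrak C$ and $|u_i(t)|<+\infty$ for all $t\ge0$ and all $i$. *)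

(* Defs.v *)
From HB Require Import structures.
From mathcomp Require Import all_boot all_order all_algebra.
From mathcomp Require Import all_classical all_reals all_analysis.

Set Implicit Arguments.
Unset Strict Implicit.
Unset Printing Implicit Defensive.

Import Order.TTheory GRing.Theory Num.Theory.
Import numFieldNormedType.Exports.

Local Open Scope classical_set_scope.
Local Open Scope ring_scope.

Section Graph.
Variables (R : realType) (N : nat).

Definition undirected_graph (e : rel 'I_N) : Prop :=
  symmetric e /\ irreflexive e.

Definition connected_graph (e : rel 'I_N) : Prop :=
  forall i j, connect e i j.

Definition edge_weights (e : rel 'I_N) (w : 'M[R]_N) : Prop :=
  [/\ forall i j, w i j = w j i,
      forall i j, e i j -> 0 < w i j &
      forall i j, ~~ e i j -> w i j = 0].

Definition laplacian (w : 'M[R]_N) : 'M[R]_N :=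
  \matrix_(i, j) (if i == j then \sum_(k < N | k != i) w i k else - w i j).

(* Eigenvalues in nondecreasing order, with algebraic multiplicity. There is at
   most one such list; when the characteristic polynomial does not split over R
   (never the case for a symmetric matrix) the value is [::]. *)
Definition sorted_eigenvalues (A : 'M[R]_N) : seq R :=
  xget [::] [set s : seq R | sorted <=%R s /\
                             char_poly A = \prod_(a <- s) ('X - a%:P)].

(* lambda_2: indices start at 0. *)
Definition second_eigenvalue (A : 'M[R]_N) : R := (sorted_eigenvalues A)`_1.

(* The library norm on matrices is the sup norm. *)
Definition euclidean_norm (v : 'cV[R]_N) : R :=
  Num.sqrt (\sum_(i < N) v i ord0 ^+ 2).

End Graph.

Section PID.
Variables (R : realType) (N : nat).
Implicit Types (w : 'M[R]_N) (rho delta : 'cV[R]_N) (x xd : R -> 'cV[R]_N).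

(* Componentwise derivative on [0, +oo[, one-sided at 0; the values at negative
   times are irrelevant. *)
Definition has_velocity x xd : Prop :=
  forall t : R, 0 <= t -> forall i : 'I_N,
    h^-1 * (x (t + h) i ord0 - x t i ord0)
      @[h --> within [set h | 0 <= t + h] (0 : R)^'] --> xd t i ord0.

Definition state_integral x (t : R) : 'cV[R]_N :=
  \col_i (\int[lebesgue_measure]_(s in `[0, t]) x s i ord0)%R.

Definition pid_control w (alpha beta gamma : R) x xd (t : R) (i : 'I_N) : R :=
  - \sum_(j < N) laplacian w i j *
      (alpha * x t j ord0 + beta * state_integral x t j ord0
       + gamma * xd t j ord0).

(* x, with velocity xd, is a trajectory of the closed-loop network. *)
Definition closed_loop w rho delta (alpha beta gamma : R) x xd : Prop :=
  has_velocity x xd /\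
  forall t : R, 0 <= t -> forall i : 'I_N,
    xd t i ord0 = rho i ord0 * x t i ord0 + delta i ord0
                  + pid_control w alpha beta gamma x xd t i.

Definition integral_state w (beta gamma : R) x (t : R) : 'cV[R]_N :=
  - (beta *: (invmx (1%:M + gamma *: laplacian w) *m laplacian w
              *m state_integral x t)).

Definition consensus_set : set 'cV[R]_N :=
  [set v | forall i j, v i ord0 = v j ord0].

(* For real-valued controls the requirement |u_i(t)| < +oo is only meaningful
   as boundedness of u_i on [0, +oo[, which is how it is stated. *)
Definition admissible_consensus w rho delta (alpha beta gamma : R) : Prop :=
  forall (x0 : 'cV[R]_N) x xd,
    closed_loop w rho delta alpha beta gamma x xd -> x 0 = x0 ->
    (exists2 l, consensus_set l & x t @[t --> +oo] --> l) /\
    (forall i, exists M : R, forall t : R, 0 <= t ->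
       `|pid_control w alpha beta gamma x xd t i| <= M).

End PID.

(* Main.v *)
(** The real and imaginary parts of the rows of a unitary matrix diagonalizing
    the Laplacian [L] over [R[i]] are [2N] real rows [r] with [r L = lam r] that
    form a Parseval frame of [R^N]; this replaces an orthonormal eigenbasis and
    decouples the network. With [xinf] the announced limit and
    [d = delta - rhostar xinf 1], which has zero sum, the scalars
    [e = r (x - xinf 1)] and [g = r (beta L y - d)], where [y] is the integral of
    [x], satisfy
      [(1 + gamma lam) e' = - (rhostar + alpha lam) e - g],  [g' = beta lam e],
    and [g = 0] when [lam = 0]. A quadratic Lyapunov function shows that both
    decay exponentially, so [x --> xinf 1] and [z --> - (1 + gamma L)^-1 d].
    In the frame, [(1 + gamma L)^-1] divides the components of [d] by
    [1 + gamma lam], where [lam >= lambda_2] for the nonzero ones, hence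
    [z_inf <= |delta| / (1 + gamma lambda_2)]. *)

Require Import Defs.
From HB Require Import structures.
From mathcomp Require Import all_boot all_order all_algebra.
From mathcomp Require Import all_classical all_reals all_analysis.
From mathcomp Require Import ring lra.
From mathcomp Require Import complex.

Import Order.TTheory GRing.Theory Num.Theory.
Import numFieldNormedType.Exports.

Local Open Scope classical_set_scope.
Local Open Scope ring_scope.

Set Implicit Arguments.
Unset Strict Implicit.

(** * The spectrum of the Laplacian *)

(** The complex spectral theorem gives a unitary [P] with [P A = D P]. As [A] and [D] are real, the
    real and imaginary parts of each row of [P] are again eigenrows, for the same eigenvalue. Some
    of these rows may vanish. *)
Lemma symmetric_eigenframe (R : rcfType) (n : nat) (A : 'M[R]_n) :
  A^T = A ->
  exists (F : 'M[R]_(n + n, n)) (lam : 'I_(n + n) -> R),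
    F^T *m F = 1%:M /\ forall k, row k F *m A = lam k *: row k F.
Proof.
move=> symA; pose phi : {rmorphism R -> R[i]} := real_complex R.
pose Ac := map_mx phi A.
have Ac_real : Ac \is a mxOver Num.real.
  by apply/mxOverP => i j; rewrite mxE complex_real.
have Ac_sym : Ac \is symmetricmx.
  apply/is_hermitianmxP; rewrite expr0 scale1r map_mx_id //.
  by apply/matrixP => i j; rewrite !mxE -[in LHS]symA mxE.
have Ac_herm := realsym_hermsym Ac_sym Ac_real.
have /orthomx_spectralP AcE := hermitian_normalmx Ac_herm.
have /mxOverP Dreal := hermitian_spectral_diag_real Ac_herm.
have Punit := spectral_unitarymx Ac.
move: AcE Dreal Punit.
set P := spectralmx Ac; set D := spectral_diag Ac => AcE Dreal Punit.
have PA : P *m Ac = diag_mx D *m P.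
  by rewrite AcE -mulmxA mulKVmx // unitarymx_unit.
have PP : invmx P *m P = 1%:M by rewrite mulVmx // unitarymx_unit.
rewrite invmx_unitary // in PP.
pose X := map_mx (@complex.Re R) P; pose Y := map_mx (@complex.Im R) P.
pose mu i := complex.Re (D 0 i).
have DE i : D 0 i = phi (mu i) by rewrite /phi /= /mu (RRe_real (Dreal 0 i)).
(* With this identity the real part of [P^* P = 1] reads [X^T X + Y^T Y = 1], the frame property of
   the stacked matrix. *)
have ReE (u v : R[i]) : complex.Re (conjc u * v) =
    complex.Re u * complex.Re v + complex.Im u * complex.Im v.
  by case: u => a b; case: v => c d /=; rewrite mulNr opprK.
have ReM (u : R[i]) (r : R) : complex.Re (u * phi r) = complex.Re u * r /\
    complex.Im (u * phi r) = complex.Im u * r.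
  by case: u => a b /=; rewrite !mulr0 subr0 add0r.
have Resum (I : finType) (f : I -> R[i]) :
    complex.Re (\sum_i f i) = \sum_i complex.Re (f i) /\
    complex.Im (\sum_i f i) = \sum_i complex.Im (f i).
  split; [apply: (big_morph (@complex.Re R)) | apply: (big_morph (@complex.Im R))] => //;
    by case=> a b [c d].
have XA i : row i X *m A = mu i *: row i X.
  apply/rowP => j; have /matrixP/(_ i j)/(congr1 (@complex.Re R)) := PA.
  rewrite mul_diag_mx !mxE DE mulrC (ReM _ _).1 (Resum _ _).1 mulrC => <-.
  by apply: eq_bigr => k _; rewrite !mxE (ReM _ _).1.
have YA i : row i Y *m A = mu i *: row i Y.
  apply/rowP => j; have /matrixP/(_ i j)/(congr1 (@complex.Im R)) := PA.
  rewrite mul_diag_mx !mxE DE mulrC (ReM _ _).2 (Resum _ _).2 mulrC => <-.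
  by apply: eq_bigr => k _; rewrite !mxE (ReM _ _).2.
exists (col_mx X Y).
exists (fun k => match fintype.split k with inl i => mu i | inr i => mu i end).
split.
  rewrite tr_col_mx mul_row_col; apply/matrixP => i j.
  have /matrixP/(_ i j)/(congr1 (@complex.Re R)) := PP.
  rewrite [X in complex.Re X]mxE (Resum _ _).1 mxE => E; rewrite [LHS]mxE.
  rewrite [RHS]mxE -[RHS]/(complex.Re (phi (i == j)%:R)) rmorph_nat.
  rewrite -E [X in X + _]mxE [X in _ + X]mxE -big_split /=.
  by apply: eq_bigr => k _; rewrite !mxE ReE.
move=> k; rewrite -(splitK k); case: (fintype.split k) => i /=.
  by rewrite (unsplitK (inl i)) rowKu XA.
by rewrite (unsplitK (inr i)) rowKd YA.
Qed.

Lemma eigenvalue_sorted_eigenvalues (R : realType) (n : nat) (A : 'M[R]_n) (a : R) :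
  sorted_eigenvalues A != [::] -> eigenvalue A a = (a \in sorted_eigenvalues A).
Proof.
rewrite /sorted_eigenvalues; case: xgetP => [s _ [_ sE] _|_]; last by rewrite eqxx.
by rewrite eigenvalue_root_char sE root_prod_XsubC.
Qed.

Section Laplacian.
Variables (R : realType) (N : nat) (e : rel 'I_N) (w : 'M[R]_N).
Hypothesis hw : edge_weights e w.
Implicit Types v : 'rV[R]_N.

Let w_sym i j : w i j = w j i. Proof. by case: hw => + _ _; apply. Qed.

Let w_ge0 i j : 0 <= w i j.
Proof.
case: hw => _ w_gt0 w_eq0; have [/w_gt0/ltW //|/w_eq0 ->//] := boolP (e i j).
Qed.

Lemma tr_laplacian : (laplacian w)^T = laplacian w.
Proof.
apply/matrixP => i j; rewrite !mxE eq_sym; case: eqVneq => [->//|_].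
by rewrite w_sym.
Qed.

Lemma mul_laplacianE v i :
  (v *m laplacian w) 0 i = \sum_j w i j * (v 0 i - v 0 j).
Proof.
rewrite mxE (bigD1 i) //= !mxE eqxx mulr_sumr [RHS](bigD1 i) //= subrr mulr0.
rewrite add0r -big_split; apply: eq_bigr => j ji /=.
by rewrite mxE (negPf ji) (w_sym j i); ring.
Qed.

Lemma const_mx_laplacian (a : R) : (const_mx a : 'rV_N) *m laplacian w = 0.
Proof.
apply/rowP => i; rewrite mul_laplacianE [RHS]mxE big1 // => j _.
by rewrite !mxE subrr mulr0.
Qed.

Lemma laplacian_const_mx (a : R) : laplacian w *m (const_mx a : 'cV_N) = 0.
Proof.
by apply: trmx_inj; rewrite trmx_mul tr_laplacian trmx_const const_mx_laplacian trmx0.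
Qed.

(** The Dirichlet form. It is doubled because the right-hand sum meets each edge in both
    orientations; exchanging the indices in one of the two copies and using the symmetry of [w]
    completes the square. *)
Lemma laplacian_form v :
  (\sum_i (v *m laplacian w) 0 i * v 0 i) *+ 2 =
  \sum_i \sum_j w i j * (v 0 i - v 0 j) ^+ 2.
Proof.
pose G i j := w i j * (v 0 i - v 0 j) * v 0 i.
have E : \sum_i (v *m laplacian w) 0 i * v 0 i = \sum_i \sum_j G i j.
  by apply: eq_bigr => i _; rewrite mul_laplacianE mulr_suml.
rewrite E mulr2n {2}exchange_big -big_split; apply: eq_bigr => i _ /=.
rewrite -big_split; apply: eq_bigr => j _ /=.
by rewrite /G (w_sym j i); ring.
Qed.

(** Rayleigh quotient: [a] times the squared norm of [v] is half the Dirichlet form. *)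
Lemma laplacian_eigenvalue_ge0 v (a : R) :
  v != 0 -> v *m laplacian w = a *: v -> 0 <= a.
Proof.
move=> v0 vL.
have [k vk] : exists k, v 0 k != 0.
  apply/existsP; apply: contraNT v0; rewrite negb_exists => /forallP v0.
  by apply/eqP/rowP => k; rewrite mxE; apply/eqP; have := v0 k; rewrite negbK.
have vv : 0 < \sum_i v 0 i ^+ 2.
  rewrite (bigD1 k) //= ltr_pwDl ?exprn_even_gt0 ?vk //.
  by apply: sumr_ge0 => i _; exact: sqr_ge0.
rewrite -(pmulr_lge0 _ vv).
have -> : a * (\sum_i v 0 i ^+ 2) = \sum_i (v *m laplacian w) 0 i * v 0 i.
  by rewrite vL mulr_sumr; apply: eq_bigr => i _; rewrite mxE -mulrA.
rewrite -(pmulrn_lge0 _ (isT : (0 < 2)%N)) laplacian_form.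
by do 2!(apply: sumr_ge0 => ? _); rewrite mulr_ge0 ?sqr_ge0.
Qed.

(** The Dirichlet form of [v] vanishes and its terms are nonnegative, so [v] agrees across each
    edge, hence along each path. *)
Lemma laplacian_kernel v : connected_graph e ->
  v *m laplacian w = 0 -> forall i j, v 0 i = v 0 j.
Proof.
move=> conn vL; have := laplacian_form v.
rewrite vL big1 ?mul0rn => [/esym/eqP|i _]; last by rewrite mxE mul0r.
rewrite psumr_eq0 => [/allP vv|i _]; last first.
  by apply: sumr_ge0 => j _; rewrite mulr_ge0 ?sqr_ge0.
have edge i j : e i j -> v 0 i = v 0 j.
  move=> eij; have /= := vv i (mem_index_enum _).
  rewrite psumr_eq0 => [/allP/(_ j (mem_index_enum _))/=|k _]; last first.
    by rewrite mulr_ge0 ?sqr_ge0.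
  case: hw => _ /(_ _ _ eij)/gt_eqF wij _.
  by rewrite mulf_eq0 wij /= sqrf_eq0 subr_eq0 => /eqP.
move=> i j; have /connectP [p + ->] := conn i j.
elim: p i => //= k p IHp i /andP[/edge -> /IHp]; exact.
Qed.

(* When [sorted_eigenvalues] is the junk value [[::]], [second_eigenvalue] is [0];
   hence this bound and the next need no splitting of the characteristic
   polynomial. *)
Lemma second_eigenvalue_laplacian_ge0 : 0 <= second_eigenvalue (laplacian w).
Proof.
rewrite /second_eigenvalue; set s := sorted_eigenvalues _.
have [s_le1|s_gt1] := leqP (size s) 1; first by rewrite nth_default.
have : eigenvalue (laplacian w) s`_1.
  rewrite eigenvalue_sorted_eigenvalues ?mem_nth //.
  by apply: contraTN s_gt1; rewrite -/s => /eqP ->.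
by case/eigenvalueP => v vL v0; exact: laplacian_eigenvalue_ge0 v0 vL.
Qed.

Lemma second_eigenvalue_laplacian_le v (a : R) :
  v != 0 -> v *m laplacian w = a *: v -> 0 < a ->
  second_eigenvalue (laplacian w) <= a.
Proof.
move=> v0 vL a0.
have ev_a : eigenvalue (laplacian w) a by apply/eigenvalueP; exists v.
have ev_0 : eigenvalue (laplacian w) 0.
  apply/eigenvalueP; exists (const_mx 1); first by rewrite const_mx_laplacian scale0r.
  apply: contraNneq v0 => /rowP c1; apply/eqP/rowP => i.
  by have := c1 i; rewrite !mxE => /eqP; rewrite oner_eq0.
rewrite /second_eigenvalue.
have [->|s0] := eqVneq (sorted_eigenvalues (laplacian w)) [::]; first exact: ltW.
move: ev_a ev_0; rewrite !eigenvalue_sorted_eigenvalues //.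
have : sorted <=%R (sorted_eigenvalues (laplacian w)).
  by rewrite /sorted_eigenvalues; case: xgetP => [s _ []|].
case: sorted_eigenvalues => [//|b s] /= bs.
have /allP min_b := order_path_min (@le_trans _ R) bs.
(* The head [b] is at most the eigenvalue [0], so [a > 0] lies in the tail, whose own head is the
   second eigenvalue. *)
rewrite !inE => /predU1P[ab|a_s].
  case/predU1P => [b0|/min_b]; first by rewrite ab -b0 ltxx in a0.
  by rewrite -ab leNgt a0.
move=> _; case: s bs a_s {min_b} => //= c s /andP[_ cs].
rewrite inE => /predU1P[->//|].
by move: (order_path_min (@le_trans _ R) cs) => /allP; apply.
Qed.

End Laplacian.

(** * Differentiable functions on the half-line *)

Section HalfLine.
Variable R : realType.
Implicit Types (f g df dg : R -> R) (t c : R).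

(* The derivative at [0] itself is not constrained, only right continuity. *)
Definition halfline_derive f df : Prop :=
  (forall t, 0 < t -> is_derive t 1 f (df t)) /\ f t @[t --> 0^'+] --> f 0.

Lemma halfline_derive_continuous f df :
  halfline_derive f df -> {within `[0, +oo[, continuous f}.
Proof.
move=> [fd f0]; apply: derivable_oy_Rcontinuous_within_itvcy; split => // t.
by rewrite in_itv/= andbT => /fd [].
Qed.

Lemma halfline_derive_cst c : halfline_derive (cst c) (cst 0).
Proof. by split=> [t _|]; [exact: is_derive_cst|exact: cvg_cst]. Qed.

Lemma halfline_deriveD f g df dg :
  halfline_derive f df -> halfline_derive g dg ->
  halfline_derive (f \+ g) (df \+ dg).
Proof.
move=> [fd f0] [gd g0]; split=> [t t0|]; last exact: cvgD.
by have := fd t t0; have := gd t t0 => ? ?; exact: is_deriveD.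
Qed.

Lemma halfline_deriveM f g df dg :
  halfline_derive f df -> halfline_derive g dg ->
  halfline_derive (f \* g) (fun t => f t * dg t + g t * df t).
Proof.
move=> [fd f0] [gd g0]; split=> [t t0|]; last exact: cvgM.
by have := fd t t0; have := gd t t0 => ? ?; exact: is_deriveM.
Qed.

Lemma halfline_deriveZ f df c :
  halfline_derive f df -> halfline_derive (fun t => c * f t) (fun t => c * df t).
Proof.
move=> /(halfline_deriveM (halfline_derive_cst c)).
by congr halfline_derive; apply/funext => t; rewrite /= mulr0 addr0.
Qed.

Lemma halfline_derive_sum (I : Type) (s : seq I) (f df : I -> R -> R) :
  (forall i, halfline_derive (f i) (df i)) ->
  halfline_derive (fun t => \sum_(i <- s) f i t) (fun t => \sum_(i <- s) df i t).
Proof.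
move=> fd; elim: s => [|i s IHs].
  have := halfline_derive_cst 0.
  by congr halfline_derive; apply/funext => t; rewrite big_nil.
have := halfline_deriveD (fd i) IHs.
by congr halfline_derive; apply/funext => t; rewrite big_cons.
Qed.

Lemma halfline_derive_expR c :
  halfline_derive (fun t => expR (c * t)) (fun t => c * expR (c * t)).
Proof.
have cid t : is_derive t 1 (fun t : R => c * t) c.
  by have := is_deriveZ c (is_derive_id t (1 : R)); rewrite /GRing.scale /= mulr1.
have ed t : is_derive t 1 (fun t : R => expR (c * t)) (c * expR (c * t)).
  have := is_derive1_comp (is_derive_expR (c * t)) (cid t).
  by rewrite mulrC.
split=> [t _ //|]; apply: cvg_at_right_filter.
suff : {for 0, continuous (fun t : R => expR (c * t))} by [].
by apply/differentiable_continuous; rewrite -derivable1_diffP; have [] := ed 0.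
Qed.

(** At [t > 0] small increments keep [t + h] nonnegative, so the restricted limit is an ordinary
    derivative. At [0] only right continuity has to be extracted. *)
Lemma velocity_halfline_derive f df :
  (forall t, 0 <= t -> h^-1 * (f (t + h) - f t)
     @[h --> within [set h | 0 <= t + h] (0 : R)^'] --> df t) ->
  halfline_derive f df.
Proof.
move=> fd; split=> [t t0|].
  have /= fdt : h^-1 *: ((f \o shift t) (h *: 1) - f t) @[h --> (0 : R)^'] --> df t.
    apply: cvg_trans (fd t (ltW t0)) => /=.
    move=> A; rewrite /nbhs /= => /= -[d /= d0 dA].
    exists (Num.min d t) => /=; first by rewrite lt_min d0.
    move=> h /=; rewrite sub0r normrN lt_min => /andP[hd ht] h0.
    have := dA h; rewrite /= sub0r normrN addrC [h *: 1]mulr1 => /(_ hd h0).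
    apply; have := ler_norm (- h); rewrite normrN => ?; lra.
  by apply: DeriveDef; [apply/cvg_ex; exists (df t)|exact: cvg_lim].
have := fd 0 (lexx 0) => {}fd.
have fd0 : h^-1 * (f h - f 0) @[h --> (0 : R)^'+] --> df 0.
  apply: cvg_trans fd; move=> A; rewrite /nbhs /= => -[d /= d0 dA].
  exists d => //= h /= hd h0; have := dA h hd; rewrite add0r; apply.
    by rewrite gt_eqF.
  exact: ltW.
have h0 : (h : R) @[h --> (0 : R)^'+] --> (0 : R).
  by apply: cvg_at_right_filter; exact: cvg_id.
(* For [h > 0] this expression is [f h], so a convergent difference quotient forces right
   continuity. *)
have : (h * (h^-1 * (f h - f 0)) + f 0) @[h --> (0 : R)^'+] --> 0 * df 0 + f 0.
  by apply: cvgD; [exact: (cvgM h0 fd0)|exact: cvg_cst].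
rewrite mul0r add0r.
apply: cvg_trans; apply: near_eq_cvg; near=> h => /=.
by rewrite mulrA divff ?mul1r ?subrK // gt_eqF.
Unshelve. all: by end_near. Qed.

Lemma integral_halfline_derive f df :
  halfline_derive f df ->
  halfline_derive (fun t => \int[lebesgue_measure]_(s in `[0, t]) f s)%R f.
Proof.
move=> fd; have /continuous_within_itvcyP[cf cf0] := halfline_derive_continuous fd.
have fint t : 0 < t -> lebesgue_measure.-integrable `[0, t] (EFin \o f).
  move=> t0; apply: continuous_compact_integrable; first exact: segment_compact.
  apply: continuous_subspaceW (halfline_derive_continuous fd).
  by apply: subset_itvl; rewrite bnd_simp.
split=> [t t0|].
  (* Integrability is taken on [[0, t + 1]] to make [t] an interior point for the fundamental
     theorem of calculus. *)
  have t1 : 0 < t + 1 by rewrite addr_gt0.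
  have ft : {for t, continuous f} by apply: cf; rewrite in_itv/= t0.
  have [] := continuous_FTC1_closed _ (fint _ t1) t0 ft; first by rewrite ltrDl.
  by move=> dF F'; apply: (DeriveDef dF); rewrite -derive1E; exact: F'.
apply: cvg_at_right_filter; rewrite set_itv1 Rintegral_set1.
exact: (parameterized_integral_cvg_left ltr01 (fint _ ltr01)).
Qed.

(** Gronwall: [f t * expR (c * t)] has nonpositive derivative, hence is nonincreasing. *)
Lemma halfline_derive_exp_decay f df c :
  halfline_derive f df -> (forall t, 0 < t -> df t <= - c * f t) ->
  forall t, 0 <= t -> f t <= f 0 * expR (- (c * t)).
Proof.
move=> fd dfle t t0.
have gd := halfline_deriveM fd (halfline_derive_expR c).
have := ler0_derive1_nincry _ _ (halfline_derive_continuous gd).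
have /= [gd' _] := gd.
move=> /(_ _ _ 0 t (lexx 0) t0) /=; rewrite mulr0 expR0 mulr1 expRN.
rewrite ler_pdivlMr ?expR_gt0 //; apply => s; rewrite in_itv/= andbT => s0.
  by have [] := gd' s s0.
rewrite derive1E (@derive_val _ _ _ _ _ _ _ (gd' s s0)).
have := dfle s s0; have := expR_gt0 (c * s); nra.
Qed.

(** The bound is on the square because that is what a quadratic Lyapunov function controls. *)
Lemma exp_decay_cvg0 f c K : 0 < c ->
  (forall t, 0 <= t -> f t ^+ 2 <= K * expR (- (c * t))) ->
  f t @[t --> +oo] --> 0.
Proof.
move=> c0 fK; apply/norm_cvg0P.
have e0 : expR (- (c * t)) @[t --> +oo] --> 0.
  have : (c * t) @[t --> +oo] --> +oo by apply: gt0_cvgMry => //; exact: cvg_cst.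
  move=> ct; exact: (cvg_comp (fun t => c * t) (fun x => expR (- x)) ct (@cvgr_expR R)).
have : Num.sqrt (K * expR (- (c * t))) @[t --> +oo] --> 0.
  rewrite -[X in _ --> X]sqrtr0 -(mulr0 K).
  apply: (@continuous_cvg _ _ _ _ _ _ (@Num.sqrt R)); first exact: sqrt_continuous.
  by apply: cvgM => //; exact: cvg_cst.
apply: squeeze_cvgr (@cvg_cst _ _ _ _ _) => //; near=> t.
rewrite normr_ge0 /= -sqrtr_sqr ler_wsqrtr // fK //.
Unshelve. all: by end_near. Qed.

End HalfLine.

(* Lyapunov function [a k e^2 + g^2 + 2 eta a e g]: without the cross term the
   energy is only nonincreasing; the cross term makes the decay strict in [g]. *)
Lemma damped_pair_exp_decay (R : realType) (a b k : R) (e g de dg : R -> R) :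
  0 < a -> 0 < b -> 0 <= k ->
  halfline_derive e de -> halfline_derive g dg ->
  (forall t, 0 < t -> a * de t = - (b * e t) - g t) ->
  (forall t, 0 < t -> dg t = k * e t) ->
  (k = 0 -> forall t, 0 <= t -> g t = 0) ->
  exists c K, 0 < c /\ forall t, 0 <= t ->
    e t ^+ 2 <= K * expR (- (c * t)) /\ g t ^+ 2 <= K * expR (- (c * t)).
Proof.
move=> a0 b0; rewrite le_eqVlt => /predU1P[<-|k0] ed gd eE gE g0.
  (* For [k = 0] the function [g] vanishes and [a e' = - b e], so [e ^+ 2] decays at rate
     [2 b / a]. *)
  have c0 : 0 < 2 * b / a by rewrite divr_gt0 ?mulr_gt0.
  exists (2 * b / a), (e 0 * e 0); split=> // t t0.
  rewrite (g0 _ t t0) // (expr2 0) mul0r; split; last first.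
    by rewrite mulr_ge0 ?expR_ge0 // -expr2 sqr_ge0.
  rewrite expr2; have eed := halfline_deriveM ed ed.
  apply: (halfline_derive_exp_decay eed) => // s s0 /=.
  have -> : de s = - (b * e s) / a.
    by rewrite -[- _](subr0) -(g0 _ s (ltW s0)) // -eE // mulrC mulKf // gt_eqF.
  by rewrite le_eqVlt; apply/orP; left; apply/eqP; field; rewrite gt_eqF.
(* The first bound ([P1]) lets the damping absorb what the cross term adds to the derivative of [W],
   leaving [W' <= - k b e^2 - eta g^2]. The second ([P2]) keeps [W] between one half and three
   halves of [a k e^2 + g^2]. *)
pose eta := Num.min (k * b / (2 * a * k + b ^+ 2)) (Num.sqrt (k / a) / 2).
have q0 : 0 < 2 * a * k + b ^+ 2 by rewrite addr_gt0 ?mulr_gt0 ?exprn_gt0.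
have eta0 : 0 < eta by rewrite lt_min !divr_gt0 ?mulr_gt0 ?sqrtr_gt0 ?divr_gt0.
have P1 : 0 <= k * b - eta * (2 * a * k + b ^+ 2).
  by rewrite subr_ge0 -ler_pdivlMr // ge_min lexx.
have P2 : 0 <= k - 4 * a * eta ^+ 2.
  rewrite subr_ge0.
  have : eta ^+ 2 <= (Num.sqrt (k / a) / 2) ^+ 2.
    by rewrite ler_pXn2r ?nnegrE ?ge_min ?lexx ?orbT ?divr_ge0 ?sqrtr_ge0 // ltW.
  rewrite expr_div_n sqr_sqrtr => [eta2|]; last by rewrite divr_ge0 // ltW.
  have : 4 * a * eta ^+ 2 <= 4 * a * (k / a / 2 ^+ 2) by rewrite ler_pM2l ?mulr_gt0.
  suff -> : 4 * a * (k / a / 2 ^+ 2) = k by [].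
  by field; rewrite gt_eqF.
(* The largest rate for which [c * (3 / 2) * (a k e^2 + g^2)] stays below [k b e^2 + eta g^2]. *)
pose c := Num.min (2 * b / (3 * a)) (2 * eta / 3).
have c0 : 0 < c by rewrite lt_min !divr_gt0 ?mulr_gt0.
have c1 : 0 <= 2 * b - 3 * a * c.
  by rewrite subr_ge0 mulrC -ler_pdivlMr ?mulr_gt0 // ge_min lexx.
have c2 : 0 <= 2 * eta - 3 * c by rewrite subr_ge0 mulrC -ler_pdivlMr // ge_min lexx orbT.
pose W t := a * k * (e t * e t) + (g t * g t + 2 * eta * a * (e t * g t)).
have Wd := halfline_deriveD (halfline_deriveZ (a * k) (halfline_deriveM ed ed))
  (halfline_deriveD (halfline_deriveM gd gd)
     (halfline_deriveZ (2 * eta * a) (halfline_deriveM ed gd))).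
have WdecE t : 0 <= t -> W t <= W 0 * expR (- (c * t)).
  move: t; apply: (halfline_derive_exp_decay Wd) => s s0 /=.
  have := eE s s0; rewrite (gE s s0); move: (e s) (g s) (de s) => x y dx dxE.
  have D : a * k * (x * dx + x * dx) + (y * (k * x) + y * (k * x) +
      2 * eta * a * (x * (k * x) + y * dx)) =
      - (2 * k * b - 2 * eta * a * k) * x ^+ 2 - 2 * eta * b * (x * y)
      - 2 * eta * y ^+ 2.
    (* The equation gives only the product [a * dx], so [dx] is first grouped with [a]. *)
    transitivity (2 * k * x * (a * dx) + (y * (k * x) + y * (k * x) +
      2 * eta * (a * k * x ^+ 2 + y * (a * dx)))); first by ring.
    by rewrite dxE; ring.
  rewrite D.
  (* [H1] and [H2] bound the derivative, [H3] and [H4] bound [c W] from above, and [H5] and [H6]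
     compare the two bounds. *)
  have H1 := mulr_ge0 (ltW eta0) (sqr_ge0 (y + b * x)).
  have H2 := mulr_ge0 P1 (sqr_ge0 x).
  have H3 := mulr_ge0 (ltW c0) (sqr_ge0 (y - 2 * eta * a * x)).
  have H4 := mulr_ge0 (ltW c0) (mulr_ge0 (mulr_ge0 (ltW a0) P2) (sqr_ge0 x)).
  have H5 := mulr_ge0 c1 (mulr_ge0 (ltW k0) (sqr_ge0 x)).
  have H6 := mulr_ge0 c2 (sqr_ge0 y).
  by lra.
have Wlow t : a * k / 2 * e t ^+ 2 <= W t /\ g t ^+ 2 / 2 <= W t.
  rewrite /W; move: (e t) (g t) => x y.
  have H1 := sqr_ge0 (y + 2 * eta * a * x).
  have H2 := mulr_ge0 (mulr_ge0 (ltW a0) P2) (sqr_ge0 x).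
  have H3 := mulr_ge0 (mulr_ge0 (ltW a0) (ltW k0)) (sqr_ge0 x).
  have H4 := sqr_ge0 y.
  by split; lra.
have ak0 : 0 < a * k by rewrite mulr_gt0.
have W0 : 0 <= W 0.
  by apply: le_trans (Wlow 0).1; rewrite mulr_ge0 ?sqr_ge0 // divr_ge0 // ltW.
(* The sum of the two constants from [Wlow] serves [e] and [g] at once. *)
exists c, ((2 / (a * k) + 2) * W 0); split=> // t t0.
have WE := WdecE t t0; have [We Wg] := Wlow t.
have WX : 0 <= W 0 * expR (- (c * t)) by rewrite mulr_ge0 ?expR_ge0.
rewrite -mulrA; move: WE WX; set X := W 0 * _ => WE WX; split; last first.
  have : 0 <= 2 / (a * k) * X by rewrite mulr_ge0 // divr_ge0 // ltW.
  by lra.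
have : e t ^+ 2 <= 2 / (a * k) * X; last by lra.
rewrite mulrAC ler_pdivlMr //; lra.
Qed.

(** * Bounded functions on the half-line *)

Definition bounded_halfline (R : realType) (f : R -> R) : Prop :=
  exists M : R, forall t, 0 <= t -> `|f t| <= M.

Section BoundedHalfLine.
Variable R : realType.
Implicit Types (f g : R -> R) (c : R).

Lemma bounded_halfline_cst c : bounded_halfline (cst c).
Proof. by exists `|c|. Qed.

Lemma bounded_halflineD f g :
  bounded_halfline f -> bounded_halfline g -> bounded_halfline (f \+ g).
Proof.
move=> [M fM] [K gK]; exists (M + K) => t t0.
by rewrite (le_trans (ler_normD _ _)) // lerD ?fM ?gK.
Qed.

Lemma bounded_halflineZ f c :
  bounded_halfline f -> bounded_halfline (fun t => c * f t).
Proof.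
by move=> [M fM]; exists (`|c| * M) => t t0; rewrite normrM ler_wpM2l ?fM.
Qed.

Lemma bounded_halfline_sum (I : Type) (s : seq I) (f : I -> R -> R) :
  (forall i, bounded_halfline (f i)) ->
  bounded_halfline (fun t => \sum_(i <- s) f i t).
Proof.
move=> fM; elim: s => [|i s IHs].
  have := bounded_halfline_cst 0.
  by congr bounded_halfline; apply/funext => t; rewrite big_nil.
have := bounded_halflineD (fM i) IHs.
by congr bounded_halfline; apply/funext => t; rewrite big_cons.
Qed.

Lemma exp_decay_bounded f c K : 0 < c ->
  (forall t, 0 <= t -> f t ^+ 2 <= K * expR (- (c * t))) -> bounded_halfline f.
Proof.
move=> c0 fK; exists (Num.sqrt K) => t t0.
have K0 : 0 <= K.
  by have := le_trans (sqr_ge0 _) (fK 0 (lexx 0)); rewrite mulr0 oppr0 expR0 mulr1.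
rewrite -sqrtr_sqr ler_wsqrtr // (le_trans (fK t t0)) //.
rewrite ler_piMr // expR_le1 oppr_le0 mulr_ge0 // ltW //.
Qed.

End BoundedHalfLine.

(** * Entrywise limits and the Euclidean norm *)

Lemma cvg_sum_seq (R : realType) (T : Type) (F : set_system T) {FF : Filter F}
    (I : Type) (s : seq I) (f : I -> T -> R) (l : I -> R) :
  (forall i, f i t @[t --> F] --> l i) ->
  \sum_(i <- s) f i t @[t --> F] --> \sum_(i <- s) l i.
Proof.
move=> fl; elim: s => [|i s IHs].
  by under eq_cvg do rewrite big_nil; rewrite big_nil; exact: cvg_cst.
under eq_cvg do rewrite big_cons.
by rewrite big_cons; exact: cvgD.
Qed.

Lemma cvg_mx_entries (R : realType) (m n : nat) (T : Type) (F : set_system T)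
    {FF : Filter F} (f : T -> 'M[R]_(m, n)) (M : 'M[R]_(m, n)) :
  (forall i j, f t i j @[t --> F] --> M i j) -> f t @[t --> F] --> M.
Proof.
move=> fM; apply/cvg_mx_entourageP => A entA.
apply: filter_forall => i; apply: filter_forall => j.
by have /cvg_entourageP/(_ A entA) := fM i j; apply: (@filterS _ F) => t /=; rewrite inE.
Qed.

Section EuclideanNorm.
Variables (R : realType) (N : nat).
Implicit Type v : 'cV[R]_N.

Lemma euclidean_norm_cvg (T : Type) (F : set_system T) {FF : Filter F}
    (f : T -> 'cV[R]_N) v :
  (forall i, f t i ord0 @[t --> F] --> v i ord0) ->
  euclidean_norm (f t) @[t --> F] --> euclidean_norm v.
Proof.
move=> fv; apply: (@continuous_cvg _ _ _ _ _ _ (@Num.sqrt R)).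
  exact: sqrt_continuous.
apply: cvg_sum_seq => i.
under eq_cvg do rewrite expr2.
by rewrite expr2; apply: cvgM.
Qed.

Lemma sqr_euclidean_norm v : euclidean_norm v ^+ 2 = \sum_i v i ord0 ^+ 2.
Proof. by rewrite sqr_sqrtr // sumr_ge0 // => i _; exact: sqr_ge0. Qed.

(** Variance identity: with [m] the mean, the left side equals the right side minus [N m^2]. *)
Lemma sum_sqr_sub_mean v :
  \sum_i (v i ord0 - N%:R^-1 * \sum_k v k ord0) ^+ 2 <= \sum_i v i ord0 ^+ 2.
Proof.
set m := N%:R^-1 * _; have [N0|N0] := eqVneq (N%:R : R) 0.
  rewrite le_eqVlt; apply/orP; left; apply/eqP; apply: eq_bigr => i _.
  by rewrite /m N0 invr0 mul0r subr0.
have mE : \sum_k v k ord0 = N%:R * m by rewrite /m mulrA divff ?mul1r.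
have -> : \sum_i (v i ord0 - m) ^+ 2 =
    \sum_i v i ord0 ^+ 2 + (- 2 * m * \sum_k v k ord0 + N%:R * m ^+ 2).
  have -> : N%:R * m ^+ 2 = \sum_(i < N) m ^+ 2.
    by rewrite sumr_const card_ord mulr_natl.
  rewrite mulr_sumr -!big_split; apply: eq_bigr => i _ /=; ring.
rewrite mE -lerBrDl subrr.
have : 0 <= N%:R * m ^+ 2 by rewrite mulr_ge0 ?sqr_ge0.
by lra.
Qed.

End EuclideanNorm.

(** * Parseval frames *)

Section Frame.
Variables (R : realType) (m n : nat) (F : 'M[R]_(m, n)).
Hypothesis FF : F^T *m F = 1%:M.

(** Entry [i] of [u = F^T (F u)]: the rows of [F] may be dependent, yet they reconstruct [u] as an
    orthonormal basis would. *)
Lemma frame_expansion (u : 'cV[R]_n) i :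
  u i 0 = \sum_k F k i * (row k F *m u) 0 0.
Proof.
rewrite -[in LHS](mul1mx u) -FF -mulmxA mxE; apply: eq_bigr => k _.
by rewrite mxE -row_mul [in RHS]mxE.
Qed.

Lemma frame_parseval (u : 'cV[R]_n) :
  \sum_i u i 0 ^+ 2 = \sum_k (row k F *m u) 0 0 ^+ 2.
Proof.
have dot p (v : 'cV[R]_p) : \sum_i v i 0 ^+ 2 = (v^T *m v) 0 0.
  by rewrite mxE; apply: eq_bigr => i _; rewrite mxE expr2.
rewrite dot -[X in _ *m X]mul1mx -FF !mulmxA -trmx_mul -mulmxA -dot.
by apply: eq_bigr => k _; rewrite -row_mul [in RHS]mxE.
Qed.

End Frame.

(** * The modes of the network *)

Section Network.
Variables (R : realType) (N : nat) (e : rel 'I_N) (w : 'M[R]_N).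
Variables (rho delta : 'cV[R]_N) (rhostar alpha beta gamma : R).
Hypotheses (N_gt0 : (0 < N)%N) (hconn : connected_graph e).
Hypothesis hw : edge_weights e w.
Hypotheses (hrhostar : 0 < rhostar) (hrho : forall i, rho i ord0 = - rhostar).
Hypotheses (halpha : 0 < alpha) (hbeta : 0 < beta) (hgamma : 0 < gamma).

Local Notation L := (laplacian w).
Let xinf : R := N%:R^-1 * ((\sum_(k < N) delta k ord0) / rhostar).
(** [rhostar * xinf] is the mean of [delta], so [dbal] is the centred disturbance, the part that the
    integral action must cancel. *)
Let dbal : 'cV[R]_N := delta - const_mx (rhostar * xinf).

Let N_neq0 : (N%:R : R) != 0. Proof. by rewrite pnatr_eq0 -lt0n. Qed.

(** By connectedness [r] is constant, and the entries of [dbal] sum to zero. *)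
Lemma kernel_mul_balanced (r : 'rV[R]_N) : r *m L = 0 -> r *m dbal = 0.
Proof.
move=> /(laplacian_kernel hw hconn) rc; pose i0 := Ordinal N_gt0.
apply/rowP => j; rewrite ord1 !mxE.
transitivity (r 0 i0 * \sum_k dbal k 0).
  by rewrite mulr_sumr; apply: eq_bigr => k _; rewrite (rc k i0).
rewrite [X in _ * X](_ : _ = 0) ?mulr0 //.
under eq_bigr do rewrite !mxE.
rewrite sumrB sumr_const card_ord -mulr_natr /xinf.
by field; rewrite N_neq0 gt_eqF.
Qed.

Lemma laplacian_eigen_scalarE (r : 'rV[R]_N) (a : R) (u : 'cV_N) :
  r *m L = a *: r -> (r *m (L *m u)) 0 0 = a * (r *m u) 0 0.
Proof. by move=> rL; rewrite mulmxA rL -scalemxAl mxE. Qed.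

Lemma balanced_inverse_norm_le (v : 'cV[R]_N) :
  (1%:M + gamma *: L) *m v = dbal ->
  (gamma * second_eigenvalue L + 1) * euclidean_norm v <= euclidean_norm delta.
Proof.
move=> vd; have [F [lam [FF FL]]] := symmetric_eigenframe (tr_laplacian hw).
have s_ge0 := second_eigenvalue_laplacian_ge0 hw.
have c0 : 0 <= gamma * second_eigenvalue L + 1.
  by rewrite addr_ge0 // mulr_ge0 // ltW.
rewrite -(@ler_pXn2r _ 2) ?nnegrE ?mulr_ge0 ?sqrtr_ge0 //.
rewrite exprMn !sqr_euclidean_norm.
(* Centring does not increase the norm, so [delta] may be replaced by [dbal] and the estimate made
   mode by mode. *)
apply: (@le_trans _ _ (\sum_i dbal i 0 ^+ 2)); last first.
  apply: le_trans (sum_sqr_sub_mean delta); rewrite le_eqVlt.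
  apply/orP; left; apply/eqP; apply: eq_bigr => i _; rewrite !mxE.
  by congr ((_ - _) ^+ 2); rewrite /xinf; field; rewrite N_neq0 gt_eqF.
rewrite !(frame_parseval FF) mulr_sumr; apply: ler_sum => k _.
have pk : (1 + gamma * lam k) * (row k F *m v) 0 0 = (row k F *m dbal) 0 0.
  rewrite -vd mulmxDl mul1mx mulmxDr [RHS]mxE -scalemxAl -scalemxAr [X in _ = _ + X]mxE.
  rewrite (laplacian_eigen_scalarE _ (FL k)); ring.
have [r0|r0] := eqVneq (row k F) 0.
  by rewrite r0 !mul0mx !mxE expr0n /= mulr0.
have := laplacian_eigenvalue_ge0 hw r0 (FL k).
(* In a mode with [lam k = 0] both [dbal] and [v] have component zero; in the others [lam k] is at
   least the second eigenvalue. *)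
rewrite le_eqVlt => /predU1P[l0|lk].
  have := FL k; rewrite -l0 scale0r => /kernel_mul_balanced rd.
  move: pk; rewrite -l0 mulr0 addr0 mul1r => ->.
  by rewrite rd mxE expr0n /= mulr0.
have sl := second_eigenvalue_laplacian_le hw r0 (FL k) lk.
rewrite -pk exprMn ler_wpM2r ?sqr_ge0 // ler_pXn2r ?nnegrE //.
  by rewrite addrC lerD2l ler_pM2l.
by rewrite addr_ge0 // mulr_ge0 // ltW.
Qed.

(** A nonzero kernel row would be an eigenrow of [L] for the negative number [- gamma^-1]. *)
Lemma laplacian_shift_unitmx : 1%:M + gamma *: L \in unitmx.
Proof.
rewrite -row_free_unit; apply/inj_row_free => v.
rewrite mulmxDr mulmx1 -scalemxAr => vL; apply/eqP; apply: contraT => v0.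
have : v *m L = - gamma^-1 *: v.
  have -> : v = - (gamma *: (v *m L)) by apply/eqP; rewrite -addr_eq0 vL.
  rewrite scaleNr scalerN opprK scalerA mulVf ?gt_eqF // scale1r.
  by congr (_ *m L); apply/eqP; rewrite eq_sym -addr_eq0 vL.
move=> /(laplacian_eigenvalue_ge0 hw v0).
by rewrite oppr_ge0 invr_le0 leNgt hgamma.
Qed.

(** * Convergence along a trajectory *)

Section Trajectory.
Variables (x xd : R -> 'cV[R]_N).
Hypothesis hx : closed_loop w rho delta alpha beta gamma x xd.

Local Notation y := (state_integral x).
Local Notation control := (fun t => \col_i pid_control w alpha beta gamma x xd t i).

Lemma controlE t :
  control t = - (L *m (alpha *: x t + beta *: y t + gamma *: xd t)).
Proof.
apply/colP => i; rewrite !mxE; congr (- _); apply: eq_bigr => j _.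
by congr (_ * _); rewrite !mxE.
Qed.

Lemma closed_loop_vectorE t : 0 <= t ->
  xd t = - (rhostar *: x t) + delta + control t.
Proof.
case: hx => _ dyn t0; apply/colP => i; rewrite dyn // hrho !mxE.
by rewrite mulNr.
Qed.

Lemma state_halfline_derive (r : 'rV[R]_N) :
  halfline_derive (fun t => (r *m x t) 0 0) (fun t => (r *m xd t) 0 0).
Proof.
have [vel _] := hx.
have := halfline_derive_sum (index_enum _) (fun j => halfline_deriveZ (r 0 j)
  (velocity_halfline_derive (fun t t0 => vel t t0 j))).
by congr halfline_derive; apply/funext => t; rewrite mxE.
Qed.

Lemma state_integral_halfline_derive (r : 'rV[R]_N) :
  halfline_derive (fun t => (r *m y t) 0 0) (fun t => (r *m x t) 0 0).
Proof.
have [vel _] := hx.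
have := halfline_derive_sum (index_enum _) (fun j => halfline_deriveZ (r 0 j)
  (integral_halfline_derive (velocity_halfline_derive (fun t t0 => vel t t0 j)))).
congr halfline_derive; apply/funext => t; rewrite mxE //.
by apply: eq_bigr => j _; rewrite mxE.
Qed.

(** The two scalars form a damped pair with coefficients [1 + gamma a], [rhostar + alpha a] and
    [beta a]. *)
Lemma mode_convergence (r : 'rV[R]_N) (a : R) : r *m L = a *: r ->
  [/\ (r *m (x t - const_mx xinf)) 0 0 @[t --> +oo] --> 0,
      (r *m (beta *: (L *m y t) - dbal)) 0 0 @[t --> +oo] --> 0 &
      bounded_halfline (fun t => (r *m control t) 0 0)].
Proof.
(* A zero row, for which [a] is arbitrary, is treated as an eigenrow for [0]. *)
wlog a0 : a / 0 <= a => [IH rL|rL].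
  have [r0|r0] := eqVneq r 0; last exact: IH (laplacian_eigenvalue_ge0 hw r0 rL) rL.
  by apply: (IH 0) => //; rewrite r0 mul0mx scaler0.
pose E t := (r *m (x t - const_mx xinf)) 0 0.
pose G t := (r *m (beta *: (L *m y t) - dbal)) 0 0.
pose c := (r *m (const_mx xinf : 'cV_N)) 0 0.
(* Since [L] kills constants, shifting the state by [xinf] does not affect the coupling terms. *)
have ac : a * c = 0.
  by rewrite /c -(laplacian_eigen_scalarE _ rL) (laplacian_const_mx hw) mulmx0 mxE.
have rD (u v : 'cV[R]_N) : (r *m (u + v)) 0 0 = (r *m u) 0 0 + (r *m v) 0 0.
  by rewrite mulmxDr mxE.
have rZ b (u : 'cV[R]_N) : (r *m (b *: u)) 0 0 = b * (r *m u) 0 0.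
  by rewrite -scalemxAr mxE.
have rN (u : 'cV[R]_N) : (r *m - u) 0 0 = - (r *m u) 0 0 by rewrite mulmxN mxE.
have rLu (u : 'cV[R]_N) : (r *m (L *m u)) 0 0 = a * (r *m u) 0 0.
  exact: laplacian_eigen_scalarE.
have EE t : E t = (r *m x t) 0 0 - c by rewrite /E rD rN.
have GE t : G t = beta * a * (r *m y t) 0 0 - (r *m dbal) 0 0.
  by rewrite /G rD rN rZ rLu mulrA.
have rdbal : (r *m dbal) 0 0 = (r *m delta) 0 0 - rhostar * c.
  by rewrite /dbal -scalemx_const rD rN rZ.
have ctl t : (r *m control t) 0 0 =
    - (a * (alpha * (r *m x t) 0 0 + beta * (r *m y t) 0 0 + gamma * (r *m xd t) 0 0)).
  by rewrite controlE rN rLu !rD !rZ.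
have dyn t : 0 <= t -> (r *m xd t) 0 0 =
    - (rhostar * (r *m x t) 0 0) + (r *m delta) 0 0 + (r *m control t) 0 0.
  by move=> t0; rewrite [in LHS]closed_loop_vectorE // !rD rN rZ.
have s0 : 0 < 1 + gamma * a by rewrite ltr_pwDl // mulr_ge0 // ltW.
have EG t : 0 <= t -> (1 + gamma * a) * (r *m xd t) 0 0 =
    - ((rhostar + alpha * a) * E t) - G t.
  move=> t0; have := dyn t t0; rewrite ctl EE GE rdbal.
  move: ((r *m xd t) 0 0) => X XE.
  rewrite mulrDl mul1r {1}XE.
  transitivity (- (rhostar * (r *m x t) 0 0) + (r *m delta) 0 0 -
    a * (alpha * (r *m x t) 0 0 + beta * (r *m y t) 0 0)); first by ring.
  transitivity (- (rhostar * (r *m x t) 0 0) + (r *m delta) 0 0 -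
    a * (alpha * (r *m x t) 0 0 + beta * (r *m y t) 0 0) + alpha * (a * c)).
    by rewrite ac mulr0 addr0.
  by ring.
have Ed : halfline_derive E (fun t => (r *m xd t) 0 0).
  have := halfline_deriveD (state_halfline_derive r) (halfline_derive_cst (- c)).
  by congr halfline_derive; apply/funext => t; rewrite /= ?EE ?addr0.
have Gd : halfline_derive G (fun t => beta * a * (r *m x t) 0 0).
  have := halfline_deriveD
    (halfline_deriveZ (beta * a) (state_integral_halfline_derive r))
    (halfline_derive_cst (- (r *m dbal) 0 0)).
  by congr halfline_derive; apply/funext => t; rewrite /= ?GE ?addr0.
have b0 : 0 < rhostar + alpha * a by rewrite ltr_pwDl // mulr_ge0 // ltW.
have [| |k [K [k0 KE]]] := damped_pair_exp_decay s0 b0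
  (mulr_ge0 (ltW hbeta) a0) Ed Gd (fun t t0 => EG t (ltW t0)).
- by move=> t _; rewrite EE mulrBr -[_ * c]mulrA ac mulr0 subr0.
- move=> /eqP; rewrite mulf_eq0 gt_eqF //= => /eqP az t _.
  by rewrite GE az mulr0 mul0r kernel_mul_balanced ?mxE ?subr0 // rL az scale0r.
have E2 t t0 := (KE t t0).1; have G2 t t0 := (KE t t0).2.
split; [exact: exp_decay_cvg0 k0 E2|exact: exp_decay_cvg0 k0 G2|].
(* Solving the state equation for the control and eliminating the velocity by [EG] makes the control
   an affine function of the bounded [E] and [G]. *)
have [M UM] : bounded_halfline (fun t =>
    ((rhostar + alpha * a) * - (1 + gamma * a)^-1 + rhostar) * E t
    + (- (1 + gamma * a)^-1 * G t + (rhostar * c - (r *m delta) 0 0))).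
  apply: bounded_halflineD; first exact/bounded_halflineZ/(exp_decay_bounded k0 E2).
  apply: bounded_halflineD; last exact: bounded_halfline_cst.
  exact/bounded_halflineZ/(exp_decay_bounded k0 G2).
exists M => t t0; apply: le_trans (UM t t0); rewrite le_eqVlt; apply/orP; left; apply/eqP.
congr `|_|.
have -> : (r *m control t) 0 0 =
    (r *m xd t) 0 0 + rhostar * (E t + c) - (r *m delta) 0 0.
  by rewrite dyn // EE; ring.
have -> : (r *m xd t) 0 0 = (1 + gamma * a)^-1 * (- ((rhostar + alpha * a) * E t) - G t).
  by rewrite -EG // mulKf // gt_eqF.
by ring.
Qed.

(** The frame expansion writes each entry as a fixed combination of modes. The second limit concerns
    [L *m y t] because [y] itself drifts along the constants when [xinf] is nonzero. *)
Lemma trajectory_limits :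
  [/\ forall i, x t i ord0 @[t --> +oo] --> xinf,
      forall i, (beta *: (L *m y t)) i ord0 @[t --> +oo] --> dbal i ord0 &
      forall i, bounded_halfline (fun t => pid_control w alpha beta gamma x xd t i)].
Proof.
have [F [lam [FF FL]]] := symmetric_eigenframe (tr_laplacian hw).
have cvgF (f : R -> 'cV[R]_N) i :
    (forall k, (row k F *m f t) 0 0 @[t --> +oo] --> 0) -> f t i 0 @[t --> +oo] --> 0.
  move=> f0; have : (\sum_k F k i * (row k F *m f t) 0 0) @[t --> +oo]
      --> \sum_k F k i * 0.
    by apply: cvg_sum_seq => k; apply: cvgM (f0 k); exact: cvg_cst.
  rewrite -mulr_suml mulr0; under eq_cvg do rewrite -(frame_expansion FF).
  exact.
have cvgB0 (f : R -> R) (l : R) : f t - l @[t --> +oo] --> 0 -> f t @[t --> +oo] --> l.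
  by move=> /(cvgD (cvg_cst l)); rewrite addr0; under eq_cvg do rewrite /= subrKC.
split=> i.
- apply: cvgB0; have := cvgF (fun t => x t - const_mx xinf) i.
  under eq_cvg do rewrite !mxE.
  by apply=> k; have [] := mode_convergence (FL k).
- apply: cvgB0; have := cvgF (fun t => beta *: (L *m y t) - dbal) i.
  under eq_cvg do rewrite mxE [X in _ + X]mxE.
  by apply=> k; have [] := mode_convergence (FL k).
- have := bounded_halfline_sum (index_enum _) (fun k => bounded_halflineZ (F k i)
    (let: And3 _ _ b := mode_convergence (FL k) in b)).
  congr bounded_halfline; apply/funext => t.
  by rewrite -(frame_expansion FF) mxE.
Qed.

Lemma integral_state_limit i :
  integral_state w beta gamma x t i ord0 @[t --> +oo] -->
  (- (invmx (1%:M + gamma *: L) *m dbal)) i ord0.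
Proof.
have [_ yd _] := trajectory_limits.
rewrite mxE; under eq_cvg do rewrite /integral_state -mulmxA scalemxAr mxE.
apply: cvgN; rewrite mxE; under eq_cvg do rewrite mxE.
by apply: cvg_sum_seq => j; apply: cvgM (yd j); exact: cvg_cst.
Qed.

End Trajectory.
End Network.

Unset Implicit Arguments.

Theorem mainTheorem1 (R : realType) (N : nat) (e : rel 'I_N) (w : 'M[R]_N)
    (rho delta : 'cV[R]_N) (rhostar alpha beta gamma : R)
    (hN : (2 <= N)%N)
    (he : undirected_graph e)
    (hconn : connected_graph e)
    (hw : edge_weights e w)
    (hrhostar : 0 < rhostar)
    (hrho : forall i, rho i ord0 = - rhostar)
    (halpha : 0 < alpha) (hbeta : 0 < beta) (hgamma : 0 < gamma) :
  admissible_consensus w rho delta alpha beta gamma /\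
  forall (x0 : 'cV[R]_N) (x xd : R -> 'cV[R]_N),
    closed_loop w rho delta alpha beta gamma x xd -> x 0 = x0 ->
    [/\ forall i, x t i ord0 @[t --> +oo] -->
          N%:R^-1 * ((\sum_(k < N) delta k ord0) / rhostar),
        cvg (euclidean_norm (integral_state w beta gamma x t) @[t --> +oo]) &
        lim (euclidean_norm (integral_state w beta gamma x t) @[t --> +oo]) <=
          Num.sqrt (N%:R ^+ 3 * (N%:R - 1))
            / (gamma * second_eigenvalue (laplacian w) + 1)
          * euclidean_norm delta].
Proof.
have N_gt0 : (0 < N)%N by exact: ltnW.
split=> x0 x xd hx _.
  have [xl _ ub] := trajectory_limits N_gt0 hconn hw hrhostar hrho halpha hbeta hgamma hx.
  split; last exact: ub.
  exists (const_mx (N%:R^-1 * ((\sum_(k < N) delta k ord0) / rhostar))).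
    by move=> i j; rewrite !mxE.
  by apply: cvg_mx_entries => i j; rewrite ord1 mxE; exact: xl.
have [xl _ _] := trajectory_limits N_gt0 hconn hw hrhostar hrho halpha hbeta hgamma hx.
pose xinf := N%:R^-1 * ((\sum_(k < N) delta k ord0) / rhostar).
pose v := invmx (1%:M + gamma *: laplacian w) *m (delta - const_mx (rhostar * xinf)).
have zl : euclidean_norm (integral_state w beta gamma x t) @[t --> +oo] -->
    euclidean_norm v.
  have -> : euclidean_norm v = euclidean_norm (- v).
    by congr Num.sqrt; apply: eq_bigr => i _; rewrite [in RHS]mxE sqrrN.
  apply: euclidean_norm_cvg => i.
  exact: (integral_state_limit N_gt0 hconn hw hrhostar hrho halpha hbeta hgamma hx).
rewrite (cvg_lim (@Rhausdorff R) zl); split; [exact: xl|exact: zl|].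
have c0 : 0 < gamma * second_eigenvalue (laplacian w) + 1.
  rewrite ltr_wpDl // mulr_ge0 ?(ltW hgamma) //.
  exact: (second_eigenvalue_laplacian_ge0 hw).
have vle : (gamma * second_eigenvalue (laplacian w) + 1) * euclidean_norm v <=
    euclidean_norm delta.
  apply: (balanced_inverse_norm_le N_gt0 hconn hw hrhostar hgamma).
  by rewrite /v mulKVmx // (laplacian_shift_unitmx hw).
rewrite mulrAC ler_pdivlMr // mulrC (le_trans vle) //.
(* The estimate [vle] is sharper than the announced one: the factor [N^3 (N - 1)] is at least [1]
   because [N >= 2]. *)
rewrite ler_peMl ?sqrtr_ge0 // -[leLHS]sqrtr1 ler_wsqrtr //.
have N2 : 2 <= N%:R :> R by rewrite (ler_nat _ 2).
rewrite -[leLHS]mulr1 ler_pM // ?exprn_ege1 //; lra.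
Qed.
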